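(* In the interview query model, the best possible (randomized) competitive ratio for finding the $B$-optimal stable matching in an instance of stable matching with one-sided uncertainty is $\Theta(n)$.
   Context: Two disjoint sets $A$, $B$ of agents with $|A|=|B|=n$. Each $a\in A$ has a strict total order $\prec_a$ on $B$ and each $b\in B$ has a strict total order $\prec_b$ on $A$ ($x\prec_y z$: $y$ prefers $x$ to $z$). A matching is a bijection between $A$ and $B$; it is stable if there is no pair $(a,b)$, $b\neq M(a)$, with $a$ preferring $b$ to $M(a)$ and $b$ preferring $a$ to $M(b)$. A stable matching is $B$-optimal if every agent of $B$ weakly prefers its partner in it to its partner in any other stable matching. One-sided uncertainty: the orders $\prec_a$ ($a\in A$) are known, the orders $\prec_b$ ($b\in B$) are unknown and learned only via queries. An interview query $\mathit{intq}(b,a)$ for $b\in B$, $a\in A$ reveals the restriction of $\prec_b$ to $\{a\}\cup P_b$, where $P_b$ is the set of all $a'\in A$ for which $\mathit{intq}(b,a')$ was executed before. An online algorithm queries adaptively until the known information proves its output correct. Its competitive ratio is the supremum over instances of the ratio between its number of queries (expected number for randomized algorithms) and the minimum size of a query set whose answers on that instance suffice to prove the correct output. *)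

(* Defs.v *)
From mathcomp Require Import all_boot all_order all_algebra.
From mathcomp Require Import all_classical all_reals all_analysis.
From mathcomp Require Import measurable_realfun.

Set Implicit Arguments.
Unset Strict Implicit.
Unset Printing Implicit Defensive.

Definition strict_total_order (T : eqType) (r : rel T) : Prop :=
  [/\ irreflexive r, transitive r & forall x y, x != y -> r x y || r y x].

(* [prefA I a x y] is x ≺_a y: agent a prefers x to y; likewise [prefB I b].
   A and B are separate type parameters, so the two sides are disjoint even
   when both are instantiated with the same n-element type. *)
Record instance (A B : finType) := Instance {
  prefA : A -> rel B;
  prefB : B -> rel A;
  prefA_strict : forall a, strict_total_order (prefA a);
  prefB_strict : forall b, strict_total_order (prefB b) }.

Record matching (A B : finType) := Matching {
  mateA : A -> B;
  mateB : B -> A;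
  mateAK : cancel mateA mateB;
  mateBK : cancel mateB mateA }.

Section StableMatching.
Variables A B : finType.
Implicit Types (I : instance A B) (M : matching A B).

Definition blocking_pair I M (a : A) (b : B) : bool :=
  [&& b != mateA M a, prefA I a b (mateA M a) & prefB I b a (mateB M b)].

Definition stable I M : Prop := ~ exists a b, blocking_pair I M a b.

Definition weakly_prefersB I (b : B) (x y : A) : Prop :=
  x = y \/ prefB I b x y.

Definition B_optimal I M : Prop :=
  stable I M /\
  forall M', stable I M' ->
    forall b, weakly_prefersB I b (mateB M b) (mateB M' b).

End StableMatching.

Section InterviewQueries.
Variables A B : finType.
Implicit Types (I : instance A B) (M : matching A B).

(* (b, a) stands for intq(b, a). *)
Definition query : Type := (B * A)%type.

(* The restriction of ≺_b to S, as the set of pairs (x, y) with x ≺_b y. *)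
Definition pref_restr I (b : B) (S : {set A}) : {set A * A} :=
  [set p : A * A | [&& p.1 \in S, p.2 \in S & prefB I b p.1 p.2]].

Definition interviewed (s : seq query) (b : B) : {set A} :=
  [set a | (b, a) \in s].

(* The answer to q when the queries in s were executed before. *)
Definition interview_answer I (s : seq query) (q : query) : {set A * A} :=
  pref_restr I q.1 (q.2 |: interviewed s q.1).

(* I' has the same known side as I and gives the same answers to the queries
   in Q.  The order in which Q is executed is irrelevant: the last answer
   concerning b contains all the previous ones. *)
Definition indistinguishable I (Q : {set query}) I' : Prop :=
  (forall a, prefA I' a =2 prefA I a) /\
  (forall b, pref_restr I' b [set a | (b, a) \in Q]
           = pref_restr I b [set a | (b, a) \in Q]).

Definition proves I (Q : {set query}) M : Prop :=
  forall I', indistinguishable I Q I' -> B_optimal I' M.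

Definition sufficient I (Q : {set query}) : Prop := exists M, proves I Q M.

(* The minimum size of a sufficient query set; the default, the set of all
   queries, reveals the whole instance. *)
Definition opt_queries I : nat :=
  #|[arg min_(Q < [set: query]%SET | `[< sufficient I Q >]) #|Q| ]|.

(* The executed queries with their answers, in chronological order. *)
Definition transcript : Type := seq (query * {set A * A}).

Definition asked (h : transcript) : seq query := [seq e.1 | e <- h].

(* A strategy sees the preferences of A and the transcript, and either makes
   a query or stops with an output. *)
Definition strategy : Type :=
  (A -> rel B) -> transcript -> query + matching A B.

(* The transcript after t steps; it is stationary once the strategy stops. *)
Fixpoint run (f : strategy) I (t : nat) : transcript :=
  if t isn't t'.+1 then [::] else
  let h := run f I t' in
  if f (prefA I) h is inl q then rcons h (q, interview_answer I (asked h) q)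
  else h.

(* Termination is not required: a diverging run has infinite cost. *)
Record algorithm := Algorithm {
  next :> strategy;
  next_sound : forall I t M,
    next (prefA I) (run next I t) = inr M ->
    proves I [set q in asked (run next I t)] M }.

End InterviewQueries.

Section CompetitiveRatio.
Variables (R : realType) (A B : finType).
Local Open Scope classical_set_scope.
Local Open Scope ereal_scope.

Definition num_queries (f : algorithm A B) (I : instance A B) : \bar R :=
  ereal_sup (range (fun t : nat => (size (run f I t))%:R%:E)).

(* A random variable with values in the deterministic algorithms, on an
   arbitrary probability space. *)
Record randomized_algorithm := RandomizedAlgorithm {
  rdisp : measure_display;
  rspace : measurableType rdisp;
  rprob : probability rspace R;
  ralg : rspace -> algorithm A B;
  ralg_meas : forall I : instance A B,
    measurable_fun [set: rspace] (fun w => num_queries (ralg w) I) }.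

Definition expected_queries (F : randomized_algorithm) (I : instance A B)
    : \bar R :=
  \int[rprob F]_w num_queries (ralg w) I.

Definition competitive_ratio (cost : instance A B -> \bar R) : \bar R :=
  ereal_sup (range (fun I => cost I / (opt_queries I)%:R%:E)).

Definition best_deterministic_ratio : \bar R :=
  ereal_inf [set r | exists f : algorithm A B,
    r = competitive_ratio (num_queries f)].

Definition best_randomized_ratio : \bar R :=
  ereal_inf [set r | exists F : randomized_algorithm,
    r = competitive_ratio (expected_queries F)].

End CompetitiveRatio.

(* f(n) = Θ(n); the bounds are eventual, as there is nothing to query for
   n <= 1. *)
Definition Theta_linear (R : realType) (f : nat -> \bar R) : Prop :=
  exists c C : R, [/\ (0 < c)%R, (0 < C)%R &
    \forall n \near \oo%classic,
      ((c * n%:R)%:E <= f n)%E /\ (f n <= (C * n%:R)%:E)%E].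

(* Main.v *)
(* Upper bound: a proof of B-optimality must interview all but one agent of B at
   least twice, since two agents of B without any comparison could both rank
   their mates last, and then the agents of A, each pointing to its best willing
   alternative, contain a cycle along which B improves. So the optimum is at
   least 2(n - 1), and asking all n^2 queries is n-competitive.

   Lower bound: every a ranks its namesake first and the rest by index, and for
   each a > 0 exactly one hidden agent h(a) < a of B prefers a to its namesake.
   The identity is then the only stable matching, and 3n queries prove it.
   An algorithm not knowing h either finds h(a) for most a, which takes about a/2
   queries each on average over h, or leaves many a unsettled; but any two
   unsettled a, a' need one of the queries (a, a'), (a', a), for otherwise they
   might be able to swap their mates. Either way it asks Omega(n^2) queries on
   average, which bounds randomized algorithms by Yao's principle. *)
Require Import Defs.
From mathcomp Require Import all_boot all_order all_algebra.
From mathcomp Require Import all_classical all_reals all_analysis.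
From mathcomp Require Import measurable_realfun zify.

Set Implicit Arguments.
Unset Strict Implicit.
Unset Printing Implicit Defensive.

(** * B-optimal stable matchings *)

Lemma strict_total_order_min (T : finType) (r : rel T) (P : pred T) (x0 : T) :
  strict_total_order r -> P x0 ->
  exists2 x, P x & forall y, P y -> y != x -> r x y.
Proof.
move=> [irr tr tot] Px0.
(* An element of [P] with the fewest predecessors works: by transitivity a predecessor in [P] would
   have fewer still. *)
case: (arg_minnP (fun x => #|[set y | r y x]|) Px0) => x Px xmin.
exists x => // y Py yx; have /orP[ryx|//] := tot _ _ yx.
have := xmin y Py; rewrite leqNgt => /negP[]; apply: proper_card.
apply/properP; split; last by exists y; rewrite inE ?irr.
by apply/fintype.subsetP => z; rewrite !inE => /tr; apply.
Qed.

Section StableMatchings.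
Variables (A B : finType).
Implicit Types (I : instance A B) (M : matching A B).

Lemma instance_eq I I' :
  (forall a, prefA I' a =2 prefA I a) -> (forall b, prefB I' b =2 prefB I b) ->
  I' = I.
Proof.
case: I I' => pA pB sA sB [pA' pB' sA' sB'] /= eA eB.
have {}eA : pA' = pA by do 3! apply/funext => ?; apply: eA.
have {}eB : pB' = pB by do 3! apply/funext => ?; apply: eB.
by subst; congr Instance; apply: Prop_irrelevance.
Qed.

Lemma prefA_irr I a : irreflexive (prefA I a).
Proof. by case: (prefA_strict I a). Qed.

Lemma prefA_trans I a : transitive (prefA I a).
Proof. by case: (prefA_strict I a). Qed.

Lemma prefA_total I a x y : x != y -> prefA I a x y || prefA I a y x.
Proof. by case: (prefA_strict I a) => _ _; apply. Qed.

Lemma prefB_irr I b : irreflexive (prefB I b).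
Proof. by case: (prefB_strict I b). Qed.

Lemma prefB_trans I b : transitive (prefB I b).
Proof. by case: (prefB_strict I b). Qed.

Lemma prefB_total I b x y : x != y -> prefB I b x y || prefB I b y x.
Proof. by case: (prefB_strict I b) => _ _; apply. Qed.

Lemma stable_not_blocking I M a b :
  stable I M -> prefA I a b (mateA M a) -> ~~ prefB I b a (mateB M b).
Proof.
move=> Mst pa; apply/negP => pb; apply: Mst; exists a, b.
rewrite /blocking_pair pa pb !andbT.
by apply: contraTneq pa => ->; rewrite prefA_irr.
Qed.

(* B-proposing deferred acceptance without the algorithm: in a largest set R of
   rejections, each justified by a better current proposer and refuting every
   stable matching, all current proposals go to different agents. *)
Theorem B_optimal_exists I : #|A| = #|B| -> exists M, B_optimal I M.
Proof.
move=> cardAB.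
(* [top R b a]: given the rejections [R], [b] now proposes to [a]. *)
pose top (R : {set B * A}) b a :=
  (b, a) \notin R /\ forall a', prefB I b a' a -> (b, a') \in R.
pose inv (R : {set B * A}) :=
  (forall b a, (b, a) \in R -> exists2 b', prefA I a b' b & top R b' a) /\
  (forall b a, (b, a) \in R -> forall M, stable I M -> mateB M b != a).
have inv0 : `[< inv finset.set0 >] by apply/asboolP; split=> b a; rewrite inE.
case: (@arg_maxnP _ _ (fun R => `[< inv R >]) (fun R => #|R|) inv0).
move=> R /asboolP[Rtop Rstable] Rmax.
have top_uniq b a a' : top R b a -> top R b a' -> a = a'.
  move=> [na ta] [na' ta']; apply/eqP/negPn/negP => /(prefB_total I b)/orP[].
  - by move=> /ta' Ra; rewrite Ra in na.
  - by move=> /ta Ra; rewrite Ra in na'.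
have top_ex b : exists a, top R b a.
  (* If everyone had rejected [b], the agents of A would hold proposals from distinct agents other
     than [b], too many for |A| = |B|. *)
  have [a Rba] : exists a, (b, a) \notin R.
    apply: contrapT => /forallNP/= allR.
    have {}allR a : (b, a) \in R by have /negP/negPn := allR a.
    have /choice[w wP] : forall a, exists b', top R b' a.
      by move=> a; have [b' _] := Rtop b a (allR a); exists b'.
    have w_inj : injective w.
      by move=> x y e; apply: (top_uniq (w x)); rewrite // e.
    have /subset_leq_card : codom w \subset predC1 b.
      apply/fintype.subsetP => _ /codomP[a ->]; rewrite inE.
      by apply/eqP => wb; have [] := wP a; rewrite wb allR.
    have : 0 < #|B| by apply/card_gt0P; exists b.
    by rewrite card_codom // cardAB cardC1; case: #|B| => // k _; rewrite ltnn.
  have [x xR xmin] := strict_total_order_min (P := fun a => (b, a) \notin R)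
    (prefB_strict I b) Rba.
  exists x; split=> // y yx; apply/negPn/negP => yR.
  have /(xmin _ yR) xy : y != x.
    by apply: contraTneq yx => ->; rewrite prefB_irr.
  by have := prefB_trans xy yx; rewrite prefB_irr.
have /choice[t tP] := top_ex.
have better b M : stable I M -> mateB M b = t b \/ prefB I b (t b) (mateB M b).
  move=> Mst; have [->|ne] := eqVneq (mateB M b) (t b); first by left.
  right; have /orP[/(proj2 (tP b)) bad|//] := prefB_total I b ne.
  by have := Rstable _ _ bad M Mst; rewrite eqxx.
(* Of two proposers to the same agent, the worse could be rejected as well, against the maximality
   of [R]. *)
have clash b1 b2 : t b1 = t b2 -> prefA I (t b1) b1 b2 -> False.
  move=> e12 p12; have b12 : b1 != b2.
    by apply: contraTneq p12 => ->; rewrite prefA_irr.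
  pose R' := (b2, t b2) |: R.
  have Rb2 : (b2, t b2) \notin R by case: (tP b2).
  have top' b : b != b2 -> top R' b (t b).
    move=> bb2; have [nb tb] := tP b; split; last first.
      by move=> a' /tb; rewrite finset.in_setU1 => ->; rewrite orbT.
    by rewrite !inE negb_or nb andbT xpair_eqE (negPf bb2).
  have /Rmax : `[< inv R' >].
    apply/asboolP; split=> b a; rewrite finset.in_setU1;
      move=> /orP[/eqP[-> ->]|Rba].
    - by exists b1; rewrite -e12 //; exact: top'.
    - have [b' b'b top_b'] := Rtop _ _ Rba.
      have ea := top_uniq _ _ _ top_b' (tP b'); rewrite ea in b'b *.
      have [eb'|nb'] := eqVneq b' b2; last by exists b' => //; exact: top'.
      rewrite eb' -e12 in b'b *; exists b1; last exact: top'.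
      exact: prefA_trans p12 b'b.
    (* If a stable [M] matched [b2] to [t b2], then [b1], which cannot do better than [t b1], would
       block it. *)
    - move=> M Mst; apply/eqP => Mb2.
      have eA : mateA M (t b1) = b2 by rewrite e12 -Mb2 mateBK.
      have := @stable_not_blocking I M (t b1) b1 Mst.
      rewrite eA => /(_ p12) /negP; apply.
      have [e|//] := better b1 M Mst.
      by move: eA b12; rewrite -e mateBK => ->; rewrite eqxx.
    - exact: Rstable.
  rewrite cardsU1 Rb2 add1n => lt_RR.
  by have : #|R| < #|R| := lt_RR; rewrite ltnn.
have t_inj : injective t.
  move=> b1 b2 e; apply/eqP/negPn/negP => /(prefA_total I (t b1))/orP[|] p.
  - exact: clash e p.
  - by rewrite e in p; apply: clash p; rewrite e.
have [s tK sK] : bijective t by apply: inj_card_bij => //; rewrite cardAB.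
exists (Matching sK tK); split; last first.
  by move=> M' M'st b; case: (better b M' M'st) => [->|]; [left|right].
(* If [b] prefers [a] to its proposal, then [a] has rejected it and holds a better one. *)
move=> [a [b /and3P[_ /= pa pb]]].
have /Rtop[b' b'b top_b'] := proj2 (tP b) _ pb.
have ea := top_uniq _ _ _ top_b' (tP b'); rewrite ea tK in b'b pa.
by have := prefA_trans pa b'b; rewrite prefA_irr.
Qed.

End StableMatchings.

Section Rotations.
Variables (A B : finType).
Implicit Types (I : instance A B) (M : matching A B).

(* Otherwise every a points to the best b below its mate that would accept it,
   and the pointers contain a cycle along which B can improve. *)
Lemma B_optimal_unsolicited I M (a0 : A) :
  B_optimal I M ->
  exists a, forall b, prefA I a (mateA M a) b -> ~~ prefB I b a (mateB M b).
Proof.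
move=> [Mst Mopt]; apply: contrapT => /forallNP/= noa.
pose ok a b := prefA I a (mateA M a) b && prefB I b a (mateB M b).
have /choice[s sP] : forall a, exists b,
    ok a b /\ forall b', ok a b' -> b' != b -> prefA I a b b'.
  move=> a; have [b okb] : exists b, ok a b.
    apply: contrapT => /forallNP/= nob; apply: (noa a) => b pab.
    by have /negP := nob b; rewrite /ok pab.
  have [b1 ? ?] := strict_total_order_min (prefA_strict I a) okb.
  by exists b1.
pose phi a := mateB M (s a).
(* On a smallest nonempty set closed under [phi], [phi] is a permutation; [M'] rotates [M] along it
   and agrees with [M] elsewhere. *)
pose closed (C : {set A}) := (C != finset.set0) && (phi @: C \subset C).
have closedT : closed [set: A]%SET.
  by rewrite /closed finset.subsetT andbT; apply/set0Pn; exists a0.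
case: (@arg_minnP _ _ closed (fun C => #|C|) closedT).
move=> C /andP[C0 phiC] Cmin.
have phi_card : #|phi @: C| == #|C|.
  rewrite eqn_leq leq_imset_card; apply: Cmin; rewrite /closed imsetS // andbT.
  by have /set0Pn[x xC] := C0; apply/set0Pn; exists (phi x); rewrite imset_f.
have phi_inj := imset_injP phi_card.
have phi_mem a : a \in C -> phi a \in C.
  by move=> aC; apply: (fintype.subsetP phiC); rewrite imset_f.
pose psi a := if a \in C then phi a else a.
have psi_inj : injective psi.
  move=> a a'; rewrite /psi; case: ifPn => aC; case: ifPn => a'C.
  - exact: phi_inj.
  - by move=> e; rewrite -e phi_mem in a'C.
  - by move=> e; rewrite e phi_mem in aC.
  - by [].
have MK : cancel (mateA M \o psi) (invF psi_inj \o mateB M).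
  by move=> a /=; rewrite mateAK invF_f.
have MK' : cancel (invF psi_inj \o mateB M) (mateA M \o psi).
  by move=> b /=; rewrite f_invF mateBK.
pose M' := Matching MK MK'.
have M'in a : a \in C -> mateA M' a = s a.
  by move=> aC; rewrite /= /psi aC /phi mateBK.
have M'out a : a \notin C -> mateA M' a = mateA M a.
  by move=> aC; rewrite /= /psi (negPf aC).
have M'B b : mateB M' b = mateB M b \/ prefB I b (mateB M' b) (mateB M b).
  have [aC|aC] := boolP (mateB M' b \in C).
  - right; have := M'in _ aC; rewrite mateBK => eb.
    by have [/andP[_]] := sP (mateB M' b); rewrite -eb.
  - by left; have := M'out _ aC; rewrite mateBK => {2}->; rewrite mateAK.
(* B only improves, so in a pair blocking [M'] the agent [b] also prefers [a] to its mate in [M].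
   Hence the pair blocks [M], or [b] is an alternative no better than [s a]. *)
have M'st : stable I M'.
  move=> [a [b /and3P[nb pa pb]]].
  have pbM : prefB I b a (mateB M b).
    by have [<-//|] := M'B b; apply: prefB_trans.
  have [aC|aC] := boolP (a \in C); last first.
    have := stable_not_blocking Mst (_ : prefA I a b _).
    by rewrite pbM -M'out // => /(_ pa).
  have [eb|neb] := eqVneq b (mateA M a).
    by move: pbM; rewrite eb mateAK prefB_irr.
  have /orP[pab|pab] := prefA_total I a neb.
    by have := stable_not_blocking Mst pab; rewrite pbM.
  rewrite M'in // in nb pa.
  have [_ /(_ b)] := sP a; rewrite /ok pab pbM => /(_ isT nb) pa'.
  by have := prefA_trans pa pa'; rewrite prefA_irr.
have /set0Pn[a aC] := C0.
have eb : mateB M' (s a) = a by rewrite -M'in // mateAK.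
have [/andP[_ pb] _] := sP a.
have := Mopt M' M'st (s a); rewrite eb => -[e|pb'].
- by move: pb; rewrite e prefB_irr.
- by have := prefB_trans pb pb'; rewrite prefB_irr.
Qed.

End Rotations.

(** * Sizes of sufficient query sets *)

(** This is [r] with [z] moved to the last place. *)
Lemma strict_total_order_last (T : eqType) (r : rel T) (z : T) :
  strict_total_order r ->
  strict_total_order (fun x y => (x != z) && ((y == z) || r x y)).
Proof.
move=> [irr tr tot]; split.
- by move=> x; rewrite irr orbF andNb.
- move=> y x w /andP[xz /orP[/eqP->|rxy]] /andP[yz /orP[wz|ryw]].
  + by rewrite eqxx in yz.
  + by rewrite eqxx in yz.
  + by rewrite xz wz.
  + by rewrite xz (tr _ _ _ rxy ryw) orbT.
- move=> x y xy; have [xz|xz] := eqVneq x z; have [yz|yz] //= := eqVneq y z.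
  + by rewrite xz yz eqxx in xy.
  + exact: tot.
Qed.

Section OptimalQuerySets.
Variables (A B : finType).
Implicit Types (I : instance A B) (M : matching A B) (Q : {set query A B}).

(** A single interview reveals no comparison; this is why two per agent are counted below. *)
Lemma pref_restr_small I b (S : {set A}) :
  #|S| <= 1 -> pref_restr I b S = finset.set0.
Proof.
move=> /card_le1P S1; apply/eqP; rewrite -finset.subset0.
apply/fintype.subsetP => -[x y]; rewrite !inE /= => /and3P[/S1 xS].
by rewrite xS inE => /eqP->; rewrite prefB_irr.
Qed.

Lemma indistinguishableT I I' :
  indistinguishable I [set: query A B]%SET I' -> I' = I.
Proof.
move=> [eA eB]; apply: instance_eq => // b x y.
by have /finset.setP/(_ (x, y)) := eB b; rewrite !inE.
Qed.

Lemma sufficientT I : #|A| = #|B| -> sufficient I [set: query A B]%SET.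
Proof.
by move=> /(B_optimal_exists I)[M MI]; exists M => I' /indistinguishableT->.
Qed.

Lemma opt_queries_spec I : #|A| = #|B| ->
  (exists2 Q, sufficient I Q & opt_queries I = #|Q|) /\
  (forall Q, sufficient I Q -> opt_queries I <= #|Q|).
Proof.
move=> cAB; have sT : `[< sufficient I [set: query A B]%SET >].
  by apply/asboolP/sufficientT.
rewrite /opt_queries.
case: (@arg_minnP _ _ (fun Q => `[< sufficient I Q >]) (fun Q => #|Q|) sT).
move=> Q /asboolP sQ Qmin; split; first by exists Q.
by move=> Q' sQ'; apply: Qmin; apply/asboolP.
Qed.

Definition demote_mates I (m : B -> A) (U : pred B) : instance A B.
Proof.
exists (prefA I) (fun b => if U b then
  fun x y => (x != m b) && ((y == m b) || prefB I b x y) else prefB I b).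
- exact: prefA_strict.
- move=> b; case: ifP => _; last exact: prefB_strict.
  exact/strict_total_order_last/prefB_strict.
Defined.

(* Two agents of B interviewed at most once each could both rank their mates
   last, and would then jointly solicit every agent of A. *)
Lemma proves_interviewed_twice I Q M b1 b2 : proves I Q M -> b1 != b2 ->
  #|[set a | (b1, a) \in Q]| <= 1 -> 1 < #|[set a | (b2, a) \in Q]|.
Proof.
move=> QM b12 c1; rewrite ltnNge; apply/negP => c2.
pose I' := demote_mates I (mateB M) (pred2 b1 b2).
have Mopt : B_optimal I' M.
  apply: QM; split=> // b.
  have [Ub|nb] := boolP (pred2 b1 b2 b).
    by rewrite !pref_restr_small //; case/pred2P: Ub => ->.
  by move: nb => /= /negPf nb; apply/finset.setP => -[x y]; rewrite !inE /= nb.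
have likes b a : pred2 b1 b2 b -> mateA M a != b -> prefB I' b a (mateB M b).
  move=> /= Ub ab; rewrite Ub eqxx andbT.
  by apply: contraNneq ab => ->; rewrite mateBK.
(* One of [b1], [b2] is not the mate of [a] and solicits it: from above the mate it blocks, from
   below it contradicts [aP]. *)
have [a aP] := B_optimal_unsolicited (mateB M b1) Mopt.
suff [b Ub ab] : exists2 b, pred2 b1 b2 b & mateA M a != b.
  have /orP[pa|pa] := prefA_total I' a ab.
  - by have /negP[] := aP b pa; apply: likes.
  - by have /negP[] := stable_not_blocking (proj1 Mopt) pa; apply: likes.
have [->|ab] := eqVneq (mateA M a) b1; last by exists b1 => //=; rewrite eqxx.
by exists b2; rewrite //= eqxx orbT.
Qed.

Lemma card_queries Q : #|Q| = \sum_b #|[set a | (b, a) \in Q]|.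
Proof.
under eq_bigr do rewrite -sum1dep_card.
by rewrite pair_big_dep -sum1_card /=; apply: eq_bigl => -[].
Qed.

Lemma sufficient_card I Q : sufficient I Q -> 2 * #|B|.-1 <= #|Q|.
Proof.
move=> [M QM]; rewrite card_queries.
have [/existsP[b0 b0P]|/existsPn noB] :=
  boolP [exists b, #|[set a | (b, a) \in Q]| <= 1]; last first.
  apply: (@leq_trans (\sum_(b : B) 2)); last first.
    by apply: leq_sum => b _; rewrite ltnNge.
  by rewrite sum_nat_const mulnC leq_mul2r leq_pred.
rewrite (bigD1 b0) //= (leq_trans _ (leq_addl _ _)) //.
apply: (@leq_trans (\sum_(b | b != b0) 2)); last first.
  apply: leq_sum => b bb0; apply: proves_interviewed_twice QM _ b0P.
  by rewrite eq_sym.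
by rewrite sum_nat_const mulnC leq_mul2r -(cardC1 b0) leqnn.
Qed.

Lemma opt_queries_ge I : #|A| = #|B| -> 2 * #|B|.-1 <= opt_queries I.
Proof. by case/(opt_queries_spec I) => -[Q /sufficient_card ? ->]. Qed.

Lemma opt_queries_le I Q :
  #|A| = #|B| -> sufficient I Q -> opt_queries I <= #|Q|.
Proof. by case/(opt_queries_spec I) => _; apply. Qed.

End OptimalQuerySets.

(** * Runs of strategies *)

Section Runs.
Variables (A B : finType).
Implicit Types (I : instance A B) (f : strategy A B).
Implicit Types (s : seq (query A B)) (h : transcript A B).

Definition replay I s : transcript A B :=
  foldl (fun h q => rcons h (q, interview_answer I (asked h) q)) [::] s.

Lemma asked_rcons h e : asked (rcons h e) = rcons (asked h) e.1.
Proof. by rewrite /asked map_rcons. Qed.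

Lemma replay_rcons I s q :
  replay I (rcons s q) =
  rcons (replay I s) (q, interview_answer I (asked (replay I s)) q).
Proof. by rewrite /replay -cats1 foldl_cat. Qed.

Lemma asked_replay I s : asked (replay I s) = s.
Proof.
by elim/last_ind: s => // s q IH; rewrite replay_rcons asked_rcons IH.
Qed.

Lemma run_replay f I t : run f I t = replay I (asked (run f I t)).
Proof.
elim: t => //= t IH; case: (f _ _) => [q|//].
by rewrite asked_rcons replay_rcons -IH.
Qed.

(** The last answer about [b] is already the restriction to all agents it has interviewed. *)
Lemma pref_restr_replay I I' s b : replay I' s = replay I s ->
  pref_restr I' b (interviewed s b) = pref_restr I b (interviewed s b).
Proof.
elim/last_ind: s => [|s [b' a] IH].
  have -> : interviewed ([::] : seq (query A B)) b = finset.set0.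
    by apply/finset.setP => a; rewrite !inE.
  by rewrite !pref_restr_small ?cards0.
rewrite !replay_rcons !asked_replay => /rcons_inj[/IH{}IH].
rewrite /interview_answer /=.
have [->|nb] := eqVneq b b'.
  suff -> : interviewed (rcons s (b', a)) b' = a |: interviewed s b' by [].
  by apply/finset.setP => x; rewrite !inE mem_rcons inE xpair_eqE eqxx.
suff -> : interviewed (rcons s (b', a)) b = interviewed s b by [].
by apply/finset.setP => x; rewrite !inE mem_rcons inE xpair_eqE (negPf nb).
Qed.

Lemma replay_all I I' s : (forall q, q \in s) ->
  prefA I' = prefA I -> replay I' s = replay I s -> I' = I.
Proof.
move=> alls eA eR; apply: instance_eq => [a|b x y]; first by rewrite eA.
by have /finset.setP/(_ (x, y)) := pref_restr_replay b eR; rewrite !inE !alls.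
Qed.

Lemma run_subset f I t : {subset asked (run f I t) <= asked (run f I t.+1)}.
Proof.
move=> q /=; case: (f _ _) => // q' qh.
by rewrite asked_rcons mem_rcons inE qh orbT.
Qed.

(** While the runs agree, they ask the same next query; avoiding [d] in one and [d'] in the other,
    it avoids both and gets the same answer. *)
Lemma run_eq f I I' d d' t : prefA I' = prefA I ->
  (forall s q, d \notin q :: s -> d' \notin q :: s ->
    interview_answer I' s q = interview_answer I s q) ->
  d \notin asked (run f I t) -> d' \notin asked (run f I' t) ->
  run f I' t = run f I t.
Proof.
move=> eA eans; elim: t => // t IH dI dI'.
have dI0 := contra (@run_subset f I t d) dI.
have dI'0 := contra (@run_subset f I' t d') dI'.
have {}IH := IH dI0 dI'0; rewrite IH in dI'0; move: dI dI'; rewrite /= IH eA.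
case: (f _ _) => // q; rewrite !asked_rcons /= !mem_rcons => dq dq'.
by rewrite eans.
Qed.

Lemma run_stationary f I M t t' : f (prefA I) (run f I t) = inr M ->
  t <= t' -> run f I t' = run f I t.
Proof.
move=> fM /subnK <-; elim: (t' - t) => // k IH.
by rewrite addSn /= IH fM.
Qed.

End Runs.

(** * Upper bound: asking every query *)

Section QueryAll.
Variables (A B : finType) (M0 : matching A B).
Implicit Types (I : instance A B) (h : transcript A B).

Lemma card_matching (M : matching A B) : #|A| = #|B|.
Proof. by apply: bij_eq_card (Bijective (@mateAK _ _ M) (@mateBK _ _ M)). Qed.

(** A strategy cannot see the instance, so its output is read off any instance reproducing the
    transcript; after all queries only the true one does. *)
Definition consistent_output p h M := exists I,
  [/\ p = prefA I, h = replay I (asked h) & B_optimal I M].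

Definition query_all : strategy A B := fun p h =>
  if [pick q | q \notin asked h] is Some q then inl q else
  if pselect (exists M, consistent_output p h M) is left ex
  then inr (projT1 (cid ex)) else inr M0.

Lemma query_all_sound I t M :
  query_all (prefA I) (run query_all I t) = inr M ->
  proves I [set q in asked (run query_all I t)] M.
Proof.
have := run_replay query_all I t; move: (run _ _ _) => h hI.
rewrite /query_all; case: pickP => // allh.
have {}allh q : q \in asked h by have /negbT/negPn := allh q.
(* The fallback [M0] is never reached: the true instance is consistent with its own transcript. *)
case: pselect => [ex [<-]|nex]; last first.
  have [M' M'opt] := B_optimal_exists I (card_matching M0).
  by case: nex; exists M', I.
case: cid => M' /= [I' [eA eR M'opt]] I''.
have <- : I' = I by apply: (replay_all allh); rewrite -?eR.
have -> : [set q in asked h] = [set: query A B]%SET.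
  by apply/finset.setP => q; rewrite !inE allh.
by move=> /indistinguishableT->.
Qed.

Definition query_all_algorithm := Algorithm query_all_sound.

Lemma size_query_all I t : size (run query_all I t) <= #|A| * #|B|.
Proof.
have -> : size (run query_all I t) = size (asked (run query_all I t)).
  by rewrite size_map.
suff /card_uniqP <- : uniq (asked (run query_all I t)).
  by rewrite mulnC -card_prod max_card.
elim: t => //= t IH; rewrite {1}/query_all.
case: pickP => [q qh|_]; first by rewrite asked_rcons rcons_uniq qh.
by case: pselect.
Qed.

End QueryAll.

(** * Hard instances *)

Lemma strict_total_order_rank (T : eqType) (f : T -> nat) :
  injective f -> strict_total_order (fun x y => f x < f y).
Proof.
move=> f_inj; split=> [x|y x z|x y xy]; [exact: ltnn|exact: ltn_trans|].
by rewrite -neq_ltn (inj_eq f_inj).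
Qed.

Section HardInstances.
Variable n : nat.
Local Notation T := 'I_n.+1.
Implicit Types (X Y : T -> T -> bool) (h : {ffun T -> T}) (a b : T).

Definition hard_rankA a b : nat := if b == a then 0 else b.+1.

Definition hard_rankB X b a : nat :=
  if a == b then n.+1 else if X b a then a : nat else n.+2 + a.

Lemma hard_rankA_inj a : injective (hard_rankA a).
Proof.
move=> x y; rewrite /hard_rankA.
have [->|_] := eqVneq x a; have [->|_] := eqVneq y a => //.
by move=> [/val_inj].
Qed.

Lemma hard_rankB_inj X b : injective (hard_rankB X b).
Proof.
move=> x y; rewrite /hard_rankB; have := ltn_ord x; have := ltn_ord y.
case: eqVneq => [->|_]; case: eqVneq => [->|_] //.
all: repeat (case: ifP => _).
all: by move=> ? ? ?; try (apply: val_inj => /=); lia.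
Qed.

(* Everyone in A ranks its namesake first and the rest by index; b ranks the a
   with X b a above its namesake and the others below it. *)
Definition hard X : instance T T :=
  Instance (fun a => strict_total_order_rank (@hard_rankA_inj a))
           (fun b => strict_total_order_rank (@hard_rankB_inj X b)).

Definition id_matching : matching T T := Matching (frefl id) (frefl id).

Lemma prefA_hard X a b : prefA (hard X) a b a = false.
Proof. by rewrite /= /hard_rankA eqxx ltn0. Qed.

Lemma prefB_hard_mate X b a : a != b -> prefB (hard X) b a b = X b a.
Proof.
move=> /negPf ab; rewrite /= /hard_rankB ab eqxx.
by case: ifP => _; have := ltn_ord a; lia.
Qed.

(** The rank of [a] for [b] depends on no bit of [X] but [X b a], so an interview reveals nothing
    about agents not interviewed. *)
Lemma pref_restr_hard X Y b (S : {set T}) :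
  (forall a, a \in S -> X b a = Y b a) ->
  pref_restr (hard X) b S = pref_restr (hard Y) b S.
Proof.
move=> XY; apply/finset.setP => -[x y]; rewrite !inE /= /hard_rankB.
by have [/XY->|] //= := boolP (x \in S); have [/XY->|] := boolP (y \in S).
Qed.

Lemma hard_indistinguishable X Y (Q : {set query T T}) :
  (forall b a, (b, a) \in Q -> X b a = Y b a) ->
  indistinguishable (hard X) Q (hard Y).
Proof.
move=> XY; split=> // b; apply/esym/pref_restr_hard => a.
by rewrite inE; apply: XY.
Qed.

Definition points_to h b a : bool := (0 < a) && (b == h a).

(** The value at 0 is free and ignored by [points_to], so every hard instance is counted equally
    often. *)
Definition descending : {set {ffun T -> T}} :=
  [set h : {ffun T -> T} | [forall a : T, (0 < a) ==> (h a < a)]].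

Lemma descendingP h a : h \in descending -> 0 < a -> h a < a.
Proof. by rewrite inE => /forallP/(_ a)/implyP. Qed.

(** The first two kinds of queries show that each b > 0 ranks agent 0 below its namesake; with
    [(b, b)], the third shows that [h a] solicits [a]. *)
Definition certificate h : {set query T T} :=
  [set (b, b) | b : T] :|: [set (b, ord0) | b : T] :|: [set (h a, a) | a : T].

Lemma card_certificate h : #|certificate h| <= 3 * n.+1.
Proof.
have im (g : T -> query T T) : #|[set g x | x : T]| <= n.+1.
  by rewrite (leq_trans (leq_imset_card _ _)) // card_ord.
have U (S S' : {set query T T}) : #|S :|: S'| <= #|S| + #|S'|.
  by rewrite cardsU leq_subr.
rewrite !mulSn mul0n addn0 addnA (leq_trans (U _ _)) // leq_add //.
by rewrite (leq_trans (U _ _)) // leq_add.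
Qed.

(* Agent 0 of A is accepted by no one else, which fixes its mate; after that,
   each a in turn is held back by the smaller agent h a. *)
Lemma certificate_proves h : h \in descending ->
  proves (hard (points_to h)) (certificate h) id_matching.
Proof.
move=> hV I' [eA eB].
have pB b x y : (b, x) \in certificate h -> (b, y) \in certificate h ->
    prefB I' b x y = prefB (hard (points_to h)) b x y.
  have mem z : (b, z) \in certificate h ->
      z \in [set a | (b, a) \in certificate h].
    by move=> bz; rewrite inE.
  move=> /mem bx /mem b_y; have /finset.setP/(_ (x, y)) := eB b.
  by rewrite [LHS]inE [RHS]inE /= bx b_y.
have Qbb b : (b, b) \in certificate h.
  by rewrite !inE; apply/orP; left; apply/orP; left; apply/imsetP; exists b.
have Qb0 b : (b, ord0) \in certificate h.
  by rewrite !inE; apply/orP; left; apply/orP; right; apply/imsetP; exists b.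
have Qh a : (h a, a) \in certificate h.
  by rewrite !inE; apply/orP; right; apply/imsetP; exists a.
split=> [[a [b /and3P[_ pa _]]]|M' M'st b0].
  by rewrite eA prefA_hard in pa.
suff idA (k : nat) : forall a, a < k -> mateA M' a = a.
  by left; rewrite /= -[in RHS](idA n.+1 b0 (ltn_ord b0)) mateAK.
elim: k => // k IH a; rewrite ltnS => ak.
apply/eqP/negPn/negP => ne; set b := mateA M' a in ne *.
have eb : mateB M' b = a by rewrite mateAK.
(* By induction all smaller agents are matched to their namesakes. *)
have ab : a < b.
  rewrite ltn_neqAle; apply/andP; split.
    by rewrite eq_sym (inj_eq val_inj).
  rewrite leqNgt; apply/negP => ba; have Mb := IH b (leq_trans ba ak).
  by move: ne; rewrite -eb -[X in mateB _ X]Mb mateAK eqxx.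
(* The blocking pair is [(b, b)] if [a] is 0, and [(a, h a)] otherwise, as [a] ranks [h a] above the
   larger [b]. *)
have [a0|a_gt0] := posnP a.
- have Mb : mateA M' b != b.
    by apply: contraNneq ne => Mb; rewrite -eb -[X in mateB _ X]Mb mateAK.
  have := @stable_not_blocking _ _ I' M' b b M'st; rewrite eA eb.
  have a00 : a = ord0 by apply: val_inj.
  rewrite a00 pB // => /(_ _)/negP; apply.
    by rewrite /= /hard_rankA eqxx (negPf Mb).
  rewrite /= /hard_rankB eqxx /points_to /=.
  by rewrite ifN ?addn0 // neq_ltn -a00 ab.
- have ca := descendingP hV a_gt0.
  have Mc : mateA M' (h a) = h a by apply: IH; exact: leq_trans ca ak.
  have ac : a != h a by rewrite neq_ltn ca orbT.
  have := @stable_not_blocking _ _ I' M' a (h a) M'st.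
  rewrite eA -{3}Mc mateAK pB // prefB_hard_mate // /points_to a_gt0 eqxx.
  move=> /(_ _)/negP; apply => //=.
  rewrite -/b /hard_rankA (negPf ne) eq_sym (negPf ac).
  by rewrite ltnS (ltn_trans ca).
Qed.

Lemma hard_descending_output h Q M : h \in descending ->
  proves (hard (points_to h)) Q M -> forall b, mateB M b = b.
Proof.
move=> hV /(_ (hard (points_to h)))[//|Mst Mopt] b.
have [idst idopt] :=
  certificate_proves hV (conj (fun _ _ _ => erefl) (fun=> erefl)).
have := idopt M Mst b; have := Mopt _ idst b; rewrite /weakly_prefersB /=.
move=> [//|p] [//|p'].
by have := ltn_trans p p'; rewrite ltnn.
Qed.

(* If [h a] has not been asked about a, nor [h a'] about a', then a and a' might
   solicit each other's mates, and swapping them would please both mates. *)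
Lemma unsettled_pair h Q M a a' : h \in descending ->
  proves (hard (points_to h)) Q M ->
  a != a' -> (h a, a) \notin Q -> (h a', a') \notin Q ->
  0 < a -> 0 < a' -> (a, a') \in Q \/ (a', a) \in Q.
Proof.
move=> hV QM aa' ha ha' a_gt0 a'_gt0.
apply: contrapT => /not_orP[/negP naa' /negP na'a].
(* [Y] makes [a'] the hidden agent of [a], and [a] that of [a']. All changed bits belong to queries
   outside [Q]. *)
pose Y b x := if x == a then b == a' else if x == a' then b == a
  else points_to h b x.
have a'a : a' != a by rewrite eq_sym.
have Yopt : B_optimal (hard Y) M.
  apply/QM/hard_indistinguishable => b x bx; rewrite /Y /points_to.
  have [xa|_] := eqVneq x a.
    rewrite xa in bx *; rewrite a_gt0 /=.
    have [eb|_] := eqVneq b (h a); first by rewrite eb (negPf ha) in bx.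
    by have [eb|//] := eqVneq b a'; rewrite eb (negPf na'a) in bx.
  have [xa'|//] := eqVneq x a'.
  rewrite xa' in bx *; rewrite a'_gt0 /=.
  have [eb|_] := eqVneq b (h a'); first by rewrite eb (negPf ha') in bx.
  by have [eb|//] := eqVneq b a; rewrite eb (negPf naa') in bx.
pose sw x := if x == a then a' else if x == a' then a else x.
have swa : sw a = a' by rewrite /sw eqxx.
have swa' : sw a' = a by rewrite /sw (negPf a'a) eqxx.
have swx x : x != a -> x != a' -> sw x = x by rewrite /sw => /negPf-> /negPf->.
have swK : involutive sw.
  move=> x; have [->|xa] := eqVneq x a; first by rewrite swa.
  by have [->|xa'] := eqVneq x a'; rewrite ?swa' // !swx.
have pa' : prefB (hard Y) a a' a.
  by rewrite prefB_hard_mate // /Y (negPf a'a) !eqxx.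
have pa : prefB (hard Y) a' a a' by rewrite prefB_hard_mate // /Y !eqxx.
have noblock x y : x = a \/ x = a' -> y != sw x ->
    ~~ prefB (hard Y) y x (sw y).
  move=> xaa' yx; have [exy|nxy] := eqVneq x y.
    rewrite -exy; apply/negP; case: xaa' => ->; rewrite ?swa ?swa' => p.
    - by have := prefB_trans p pa'; rewrite prefB_irr.
    - by have := prefB_trans p pa; rewrite prefB_irr.
  have -> : sw y = y.
    by case: xaa' nxy yx => ->; rewrite ?swa ?swa' => nxy yx;
      apply: swx => //; rewrite eq_sym.
  rewrite prefB_hard_mate // /Y; case: xaa' yx nxy => ->.
  - by rewrite eqxx swa.
  - by rewrite (negPf a'a) eqxx swa'.
have swst : stable (hard Y) (Matching swK swK).
  move=> [x [y /and3P[/= yx px py]]].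
  have [xa|xa] := eqVneq x a.
    by have := noblock x y (or_introl xa) yx; rewrite [prefB _ _ _ _]py.
  have [xa'|xa'] := eqVneq x a'.
    by have := noblock x y (or_intror xa') yx; rewrite [prefB _ _ _ _]py.
  by rewrite swx // in px; have := prefA_hard Y x y; rewrite /= px.
(* [M] is the identity, but agent [a] of B prefers its mate in the stable swap. *)
have [_ /(_ _ swst a)] := Yopt.
rewrite (hard_descending_output hV QM) /= swa => -[e|p].
  by rewrite e eqxx in aa'.
by have := prefB_trans p pa'; rewrite prefB_irr.
Qed.

End HardInstances.

(** * Averaging over the hard instances *)

Section Averaging.
Variable n : nat.
Local Notation T := 'I_n.+1.
Implicit Types (h : {ffun T -> T}) (a v : T) (Q : {set query T T}).

Definition redirect h a v : {ffun T -> T} :=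
  [ffun x => if x == a then v else h x].

Lemma redirect_descending h a v :
  h \in descending n -> v < a -> redirect h a v \in descending n.
Proof.
move=> hV va; rewrite inE; apply/forallP => x; apply/implyP => x0.
by rewrite ffunE; case: eqP => [->|_] //; apply: descendingP.
Qed.

Lemma redirectK h a v : redirect (redirect h a v) a (h a) = h.
Proof. by apply/ffunP => x; rewrite !ffunE; case: eqP => // ->. Qed.

Lemma card_lt_neq a v : v < a -> #|[pred w : T | (w < a) && (w != v)]| = a.-1.
Proof.
move=> va; have := cardD1 v [pred w : T | w < a]; rewrite !inE va add1n.
have -> : #|[pred w : T | w < a]| = a.
  rewrite -[RHS]card_ord -[RHS]sum1_card -sum1_card.
  by rewrite [RHS](big_ord_widen n.+1 (fun=> 1)) // ltnW.
by move=> /(congr1 predn)/= ->; apply: eq_card => w; rewrite !inE andbC.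
Qed.

(* Redirecting a from h a to v is an involution on the pairs (h, v); by the
   hypothesis, at least one of the two runs pays a query outside its own
   hidden edge, or both leave a unsettled. *)
Lemma redirect_average (Q : {ffun T -> T} -> {set query T T}) a :
  0 < a ->
  (forall h v, h \in descending n -> v < a ->
    (v, a) \notin Q h -> (h a, a) \notin Q (redirect h a v) ->
    (h a, a) \notin Q h /\ (v, a) \notin Q (redirect h a v)) ->
  \sum_(h in descending n) a.-1 <=
  \sum_(h in descending n) \sum_(v : T | (v < a) && (v != h a))
    (2 * ((v, a) \in Q h) + ((h a, a) \notin Q h)).
Proof.
move=> a_gt0 HQ.
pose P (p : {ffun T -> T} * T) :=
  (p.1 \in descending n) && ((p.2 < a) && (p.2 != p.1 a)).
pose F (p : {ffun T -> T} * T) :=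
  2 * ((p.2, a) \in Q p.1) + ((p.1 a, a) \notin Q p.1).
pose s (p : {ffun T -> T} * T) := (redirect p.1 a p.2, p.1 a).
have sK : involutive s.
  by move=> [h v]; rewrite /s /= redirectK ffunE eqxx.
have sP p : P p -> P (s p).
  move=> /and3P[hV va vh]; rewrite /P /= redirect_descending //=.
  by rewrite (descendingP hV) //= ffunE eqxx eq_sym.
(* A query outside the hidden edge in either run contributes 2; without one, both runs leave [a]
   unsettled and contribute 1 each. *)
have F2 p : P p -> 2 <= F p + F (s p).
  move=> /and3P[]; case: p => h v /= hV va vh; rewrite /F /= ffunE eqxx.
  case: (boolP ((v, a) \in Q h)) => [|c]; first by lia.
  case: (boolP ((h a, a) \in Q (redirect h a v))) => [|c']; first by lia.
  by have [-> ->] := HQ h v hV va c c'.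
have -> : \sum_(h in descending n) a.-1 = \sum_(p | P p) 1.
  rewrite -(pair_big_dep (mem (descending n))
    (fun h v => (v < a) && (v != h a)) (fun _ _ => 1)) /=.
  apply: eq_bigr => h hV; rewrite sum1_card -(card_lt_neq (descendingP hV a_gt0)).
  by apply: eq_card => w; rewrite !inE.
rewrite pair_big_dep /= -/(\sum_(p | P p) F p).
have eF : \sum_(p | P p) F p = \sum_(p | P p) F (s p).
  rewrite (reindex_inj (inv_inj sK)); apply: eq_bigl => p.
  by apply/idP/idP => [/sP|/sP //]; rewrite sK.
rewrite -(leq_pmul2l (_ : 0 < 2)) // [2 * \sum_(p | P p) F p]mul2n -addnn {2}eF.
by rewrite -big_split big_distrr /=; apply: leq_sum => p /F2.
Qed.

(** Each query covers at most two ordered pairs; the last term pays for the diagonal. *)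
Lemma pairs_le Q (U : {set T}) :
  (forall a a', a \in U -> a' \in U -> a != a' ->
    (a, a') \in Q \/ (a', a) \in Q) ->
  #|U| * #|U| <= 2 * #|Q| + #|U|.
Proof.
move=> UQ.
have sumQ : \sum_(a : T) \sum_(a' : T) ((a, a') \in Q : nat) = #|Q|.
  rewrite pair_big -sum1_card [RHS]big_mkcond; apply: eq_bigr => -[b a] _ /=.
  by case: ifP.
have -> : #|U| * #|U| = \sum_(a in U) \sum_(a' in U) 1.
  by rewrite !sum_nat_const muln1.
apply: (@leq_trans (\sum_(a : T) \sum_(a' : T)
    (((a, a') \in Q) + ((a', a) \in Q) + (a == a') * (a \in U)))).
  rewrite big_mkcond; apply: leq_sum => a _; case: ifPn => // aU.
  rewrite big_mkcond; apply: leq_sum => a' _; case: ifPn => // a'U.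
  have [eaa|ne] := boolP (a == a'); first by lia.
  by have [->|->] := UQ a a' aU a'U ne; lia.
under eq_bigr do rewrite !big_split /=.
rewrite !big_split /= sumQ exchange_big /= sumQ mul2n -addnn leq_add2l.
rewrite -sum1_card [leqRHS]big_mkcond; apply: leq_sum => a _.
rewrite (bigD1 a) //= eqxx mul1n big1 ?addn0; first by case: ifP.
by move=> a' /negPf; rewrite eq_sym => ->.
Qed.

Lemma sum_pred_ord : 2 * \sum_(a : T) a.-1 = n * n.-1.
Proof.
rewrite big_ord_recl /= add0n -[RHS]muln1.
elim: n => [|k IH]; first by rewrite big_ord0.
rewrite big_ord_recr /= mulnDr IH /bump /=; case: k {IH} => [|k]; lia.
Qed.

Lemma average_queries (Q : {ffun T -> T} -> {set query T T}) : 80 <= n ->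
  (forall h a v, h \in descending n -> 0 < a -> v < a ->
    (v, a) \notin Q h -> (h a, a) \notin Q (redirect h a v) ->
    (h a, a) \notin Q h /\ (v, a) \notin Q (redirect h a v)) ->
  (forall h a a', h \in descending n -> a != a' ->
    (h a, a) \notin Q h -> (h a', a') \notin Q h -> 0 < a -> 0 < a' ->
    (a, a') \in Q h \/ (a', a) \in Q h) ->
  #|descending n| * (n * n) <= 27 * \sum_(h in descending n) #|Q h|.
Proof.
move=> n_ge Hred Hpair.
pose U h := [set a : T | (0 < a) && ((h a, a) \notin Q h)].
have UQ h : h \in descending n -> #|U h| * #|U h| <= 2 * #|Q h| + #|U h|.
  move=> hV; apply: pairs_le => a a'.
  rewrite !inE => /andP[a0 ha] /andP[a'0 ha'].
  by move=> aa'; apply: Hpair.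
have Un h : #|U h| <= n.+1 by rewrite (leq_trans (max_card _)) // card_ord.
(* In the sum of [redirect_average] over [a], each query [(v, a)] counts at most once with weight 2,
   and each unsettled [a] at most [n] times. *)
have step : \sum_(h in descending n) \sum_(a : T) a.-1 <=
    \sum_(h in descending n) (2 * #|Q h| + n * #|U h|).
  rewrite exchange_big /=.
  apply: (@leq_trans (\sum_(a : T | 0 < a) \sum_(h in descending n)
      \sum_(v : T | (v < a) && (v != h a))
        (2 * ((v, a) \in Q h) + ((h a, a) \notin Q h)))).
    rewrite [leqRHS]big_mkcond; apply: leq_sum => a _; case: ifPn => a0.
      by apply: redirect_average => // h v hV; apply: Hred.
    by rewrite -eqn0Ngt in a0; rewrite (eqP a0) big1.
  rewrite exchange_big /=; apply: leq_sum => h hV.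
  apply: (@leq_trans (\sum_(a : T) (2 * \sum_(v : T) ((v, a) \in Q h)
      + n * (a \in U h)))).
    rewrite big_mkcond; apply: leq_sum => a _; case: ifPn => // a0.
    rewrite big_split -big_distrr /= leq_add //.
      rewrite leq_mul2l /= [leqLHS]big_mkcond; apply: leq_sum => v _.
      by case: ifP.
    rewrite inE a0 /= sum_nat_const leq_mul2r; apply/orP; right.
    rewrite (_ : #|_| = a.-1); first by have := ltn_ord a; lia.
    by rewrite -(card_lt_neq (descendingP hV a0)); apply: eq_card => w;
      rewrite !inE.
  rewrite big_split /= -!big_distrr /= leq_add // leq_mul2l; apply/orP; right.
    rewrite exchange_big pair_big -sum1_card [leqRHS]big_mkcond /=.
    by apply: leq_sum => -[v a] _ /=; case: ifP.
  by rewrite -sum1_card [leqRHS]big_mkcond; apply: leq_sum => a _; case: ifP.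
have tot : #|descending n| * (n * n.-1) <=
    \sum_(h in descending n) (4 * #|Q h| + 2 * (n * #|U h|)).
  rewrite -sum_pred_ord mulnCA -sum_nat_const.
  apply: (@leq_trans (2 * \sum_(h in descending n) (2 * #|Q h| + n * #|U h|))).
    by rewrite leq_mul2l.
  by rewrite big_distrr /=; apply: leq_sum => h _; lia.
(* The count below gives 12 n^2 against 320 queries on average; 27 is 160/6 rounded up. *)
rewrite -(leq_pmul2l (_ : 0 < 6)) //.
apply: (@leq_trans (160 * \sum_(h in descending n) #|Q h|)); last by lia.
pose K := 2 * (n * n) + 128 * n.+1.
have tot16 : 16 * (#|descending n| * (n * n.-1)) <=
   \sum_(h in descending n) (320 * #|Q h| + K).
  rewrite (leq_trans (leq_mul (leqnn 16) tot)) // big_distrr /=.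
  apply: leq_sum => h hV; have := UQ h hV; have := Un h.
  move: #|U h| #|Q h| => u q un uq.
  (* Weighted so that the n^2 term stays well below 16 n (n - 1), while [uq] turns u^2 into
     queries. *)
  have sq : 32 * (n * u) <= 128 * (u * u) + 2 * (n * n).
    by have := (nat_Cauchy (8 * u) n).1; rewrite -!mulnn; lia.
  by rewrite /K; lia.
have sumK : \sum_(h in descending n) (320 * #|Q h| + K) =
    320 * \sum_(h in descending n) #|Q h| + #|descending n| * K.
  by rewrite big_split /= sum_nat_const [in RHS]big_distrr.
have nn : n * n.-1 + n = n * n by rewrite -mulnSr prednK // (leq_trans _ n_ge).
have n80 : 80 * n <= n * n by rewrite leq_mul2r n_ge orbT.
(* It amounts to 144 n + 128 <= 2 n^2, which holds from n = 80 on. *)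
have key : 12 * (n * n) + K <= 16 * (n * n.-1) by rewrite /K; lia.
have := leq_mul (leqnn #|descending n|) key; move: tot16.
rewrite sumK mulnDr; clearbody K; clear.
move: (\sum_(_ in _) _) #|descending n| (n * n) (n * n.-1) => S V s p.
by lia.
Qed.

End Averaging.

Import Order.TTheory GRing.Theory Num.Theory.

(** * Competitive ratios *)

Section CompetitiveRatios.
Variable R : realType.
Local Open Scope ereal_scope.

Lemma num_queries_ge (A B : finType) (f : algorithm A B) I t :
  (size (run f I t))%:R%:E <= num_queries R f I.
Proof. by apply: ereal_sup_ubound; exists t. Qed.

Lemma num_queries_ge0 (A B : finType) (f : algorithm A B) I :
  0 <= num_queries R f I.
Proof. exact: num_queries_ge f I 0%N. Qed.

Lemma num_queries_diverge (A B : finType) (f : algorithm A B) I :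
  (forall t M, Defs.next f (prefA I) (run f I t) <> inr M) ->
  num_queries R f I = +oo.
Proof.
move=> div; have size_run t : size (run f I t) = t.
  elim: t => //= t IH; case e : (Defs.next f _ _) => [q|M];
    last by case: (div t M).
  by rewrite size_rcons IH.
apply/eqyP => x x_gt0.
apply: le_trans (num_queries_ge f I (Num.bound x)).
by rewrite size_run lee_fin ltW // archi_boundP // ltW.
Qed.

Lemma best_deterministic_le (m : nat) : (1 < m)%N ->
  best_deterministic_ratio R 'I_m 'I_m <= m%:R%:E.
Proof.
move=> m1; have cI := erefl #|'I_m|.
pose f := query_all_algorithm (Matching (frefl (@id 'I_m)) (frefl (@id 'I_m))).
apply: (@le_trans _ _ (competitive_ratio (num_queries R f))).
  by apply: ereal_inf_lbound; exists f.
apply: ge_ereal_sup => _ [I _ <-].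
(* 2 (m - 1) >= m because m >= 2; so m^2 queries are at most m times the optimum. *)
have optm : (m <= opt_queries I)%N.
  by have := opt_queries_ge I cI; rewrite card_ord; lia.
have opt0 : (0 < (opt_queries I)%:R :> R)%R by rewrite ltr0n; lia.
rewrite inver gt_eqF // lee_pdivrMr // -EFinM -natrM.
apply: ge_ereal_sup => _ [t _ <-].
rewrite lee_fin ler_nat (leq_trans (size_query_all _ _ _)) // !card_ord.
by rewrite leq_mul2l optm orbT.
Qed.

(** A deterministic algorithm is a random variable on the one-point space. *)
Lemma best_randomized_le (A B : finType) :
  best_randomized_ratio R A B <= best_deterministic_ratio R A B.
Proof.
apply: le_ereal_inf_tmp => _ [f ->]; apply: ereal_inf_lbound.
have mf (I : instance A B) :
    measurable_fun [set: unit] (fun=> num_queries R f I) by [].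
exists (@RandomizedAlgorithm R A B _ unit (@dirac _ unit tt R) (fun=> f) mf).
congr competitive_ratio; apply/funext => I.
rewrite -[LHS]mule1 -(diracT R tt).
exact: esym (integral_cst (@dirac _ unit tt R) measurableT (num_queries R f I)).
Qed.

Lemma hard_sum_queries (n : nat) (f : algorithm 'I_n.+1 'I_n.+1) :
  (80 <= n)%N ->
  (#|descending n|%:R * (n * n)%:R / 27%:R)%:E <=
  \sum_(h in descending n) num_queries R f (hard (points_to h)).
Proof.
move=> n_ge; pose I h := hard (points_to h) : instance 'I_n.+1 'I_n.+1.
(* One diverging run already makes the sum infinite. *)
have [[h [hV div]]|stops] := pselect (exists h, h \in descending n /\
    forall t M, Defs.next f (prefA (I h)) (run f (I h) t) <> inr M).
  rewrite (bigD1 h) //= num_queries_diverge // addye ?leey //.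
  rewrite gt_eqF // (lt_le_trans ltNy0) //.
  by apply: sume_ge0 => h' _; exact: num_queries_ge0.
have /choice[t tP] : forall h, exists t, h \in descending n ->
    exists M, Defs.next f (prefA (I h)) (run f (I h) t) = inr M.
  move=> h; have [hV|nV] := boolP (h \in descending n); last by exists 0%N.
  apply: contrapT => /forallNP nt; apply: stops; exists h; split=> // t M e.
  by apply: (nt t) => _; exists M.
(* A common time by which all these runs have stopped, so that they can be compared step by step. *)
pose tm := (\max_(h : {ffun 'I_n.+1 -> 'I_n.+1}) t h)%N.
pose Q h := [set q in asked (run f (I h) tm)] : {set query 'I_n.+1 'I_n.+1}.
have Qproves h : h \in descending n -> exists M, proves (I h) (Q h) M.
  move=> hV; have [M e] := tP h hV; exists M; rewrite /Q.
  rewrite (run_stationary e); last exact: leq_bigmax.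
  exact: next_sound e.
have leQ h : #|Q h|%:R%:E <= num_queries R f (I h).
  apply: le_trans (num_queries_ge f (I h) tm); rewrite lee_fin ler_nat.
  rewrite -(size_map fst) -/(asked _) cardsE; exact: card_size.
apply: (@le_trans _ _ (\sum_(h in descending n) #|Q h|%:R%:E)); last first.
  by apply: lee_sum => h _.
rewrite sumEFin -natr_sum lee_fin -natrM ler_pdivrMr ?ltr0n //.
rewrite -natrM ler_nat [leqRHS]mulnC; apply: average_queries => //.
- move=> h a v hV a0 va vQ hQ.
  have run_hv : run f (I (redirect h a v)) tm = run f (I h) tm.
    (* The instances differ only in the bits of these two queries, and each run avoids the hidden
       edge of the other instance. *)
    apply: (@run_eq _ _ f _ _ (v, a) (h a, a)) => //.
    + move=> s [b x] vs hs; apply: pref_restr_hard => y yS.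
      have byS : (b, y) \in (b, x) :: s.
        by move: yS; rewrite !inE /= xpair_eqE eqxx.
      rewrite /points_to ffunE; have [ya|//] := eqVneq y a.
      rewrite ya in byS *; have [bv|_] := eqVneq b v.
        by rewrite -bv byS in vs.
      have [bh|//] := eqVneq b (h a).
      by rewrite -bh byS in hs.
    + by move: vQ; rewrite inE.
    + by move: hQ; rewrite inE.
  have eQ : Q (redirect h a v) = Q h by rewrite /Q run_hv.
  by rewrite eQ in hQ *.
- move=> h a a' hV aa' ha ha' a0 a'0; have [M QM] := Qproves h hV.
  exact: unsettled_pair hV QM aa' ha ha' a0 a'0.
Qed.

(* Yao's principle: the sum of the expected costs over the hard instances is the
   expectation of a sum that is large for each deterministic algorithm. *)
Lemma expected_queries_hard (n : nat)
    (F : randomized_algorithm R 'I_n.+1 'I_n.+1) : (80 <= n)%N ->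
  (#|descending n|%:R * (n * n)%:R / 27%:R)%:E <=
  \sum_(h in descending n) expected_queries F (hard (points_to h)).
Proof.
move=> n_ge.
pose T h (w : rspace F) := num_queries R (ralg w) (hard (points_to h)).
have T0 h w : 0 <= T h w by exact: num_queries_ge0.
have mT h : measurable_fun [set: rspace F] (T h).
  exact: ralg_meas.
rewrite -big_enum -(@ge0_integral_sum _ _ _ (rprob F) _ _ _ T) //.
set c := _%:E.
rewrite -[c]mule1 -(@probability_setT _ _ _ (rprob F)) -integral_cst //.
apply: ge0_le_integral => //.
- by move=> w _; rewrite lee_fin divr_ge0 // mulr_ge0.
- by apply: emeasurable_sum.
- by move=> w _; rewrite big_enum; exact: hard_sum_queries.
Qed.

Lemma best_randomized_ge (n : nat) : (80 <= n)%N ->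
  ((n * n)%:R / (100 * n.+1)%:R)%:E <= best_randomized_ratio R 'I_n.+1 'I_n.+1.
Proof.
move=> n_ge; apply: le_ereal_inf_tmp => _ [F ->].
rewrite leNgt; apply/negP => lt.
(* As the optimum is at most 3 (n + 1), a smaller ratio would cap every expected cost at 3 n^2 /
   100, below the average n^2 / 27 forced by [expected_queries_hard]. *)
have small h : h \in descending n ->
    expected_queries F (hard (points_to h)) <= ((n * n)%:R * 3 / 100)%:E.
  move=> hV; set I := hard _.
  have opt_gt0 : (0 < (opt_queries I)%:R :> R)%R.
    by have := opt_queries_ge I erefl; rewrite card_ord ltr0n; lia.
  have opt_le : (opt_queries I <= 3 * n.+1)%N.
    apply: leq_trans (card_certificate h); apply: opt_queries_le => //.
    by exists (id_matching n); apply: certificate_proves.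
  have : expected_queries F I / (opt_queries I)%:R%:E <=
      ((n * n)%:R / (100 * n.+1)%:R)%:E.
    by apply/ltW/(le_lt_trans _ lt)/ereal_sup_ubound; exists I.
  rewrite inver gt_eqF // lee_pdivrMr // => /le_trans; apply.
  rewrite -EFinM lee_fin; apply: (@le_trans _ _
    ((n * n)%:R / (100 * n.+1)%:R * (3 * n.+1)%:R))%R.
    by rewrite ler_wpM2l ?divr_ge0 // ler_nat.
  rewrite !(natrM _ _ n.+1) invfM -!mulrA (mulrCA n.+1%:R^-1%R).
  by rewrite mulVf ?pnatr_eq0 // mulr1 (mulrC 100^-1%R).
have := expected_queries_hard F n_ge; apply/negP; rewrite -ltNge.
apply: (le_lt_trans (lee_sum _ small)).
rewrite sumEFin lte_fin sumr_const -[ltLHS]mulr_natl -!mulrA ltr_pM2l.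
  rewrite ltr_pM2l; last by rewrite ltr0n muln_gt0; lia.
  by rewrite ltr_pdivrMr // mulrC ltr_pdivlMr // -natrM ltr_nat.
rewrite ltr0n; apply/card_gt0P; exists [ffun=> ord0].
by rewrite inE; apply/forallP => a; rewrite ffunE; apply/implyP.
Qed.

End CompetitiveRatios.

Theorem theorem19 (R : realType) :
  Theta_linear (fun n => best_deterministic_ratio R 'I_n 'I_n) /\
  Theta_linear (fun n => best_randomized_ratio R 'I_n 'I_n).
Proof.
(* The hard instances have size [n.+1] with n >= 80; the constant 1/200 comes from (n + 1)^2 <= 2
   n^2. *)
have lower n : (81 <= n)%N ->
    ((1 / 200 * n%:R)%R%:E <= best_randomized_ratio R 'I_n 'I_n)%E.
  case: n => // n n_ge; apply: le_trans (best_randomized_ge R n_ge).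
  rewrite lee_fin ler_pdivlMr ?ltr0n // div1r -mulrA ler_pdivrMl //.
  by rewrite -!natrM ler_nat; nia.
split; exists (1 / 200)%R, 1%R; split=> //; exists 81%N => // n /= n_ge.
- split; first exact: le_trans (lower n n_ge) (best_randomized_le _ _ _).
  by rewrite mul1r; apply: best_deterministic_le; lia.
- split; first exact: lower.
  rewrite mul1r; apply: le_trans (best_randomized_le _ _ _) _.
  by apply: best_deterministic_le; lia.
Qed.
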